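(* Let $f(z)=z+a_2z^2+a_3z^3+\cdots$ belong to the class $R$. Then $$|a_2a_3-a_4|\leq\frac{1}{2}.$$ The inequality is sharp: equality is attained by the function $$f(z)=\int_0^z\frac{1+t^3}{1-t^3}\,dt.$$
   Context: Let $E=\{z\in\mathbb{C}:|z|<1\}$ be the open unit disk and let $A$ be the class of functions $f(z)=z+a_2z^2+a_3z^3+\cdots$ analytic in $E$. The class $R$ of functions of bounded turning consists of all $f\in A$ such that $\operatorname{Re} f'(z)>0$ for all $z\in E$. *)

(* Defs.v *)
From Stdlib Require Import Reals.
From Coquelicot Require Import Coquelicot.

Open Scope C_scope.

Definition in_E (z : C) : Prop := (Cmod z < 1)%R.

(* f(z) = z + a_2 z^2 + a_3 z^3 + ... on E; the a_n are the Taylor coefficients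
   of f at 0, indexed from 0. *)
Definition has_expansion (f : C -> C) (a : nat -> C) : Prop :=
  a 0%nat = 0 /\ a 1%nat = 1 /\
  forall z : C, in_E z -> is_pseries a z (f z).

(* [ex_derive] on C -> C is complex differentiability: the scalars are the
   complex numbers (C_AbsRing). *)
Definition analytic_in_E (f : C -> C) : Prop :=
  forall z : C, in_E z -> ex_derive (K := C_AbsRing) (V := C_NormedModule) f z.

Definition class_A (f : C -> C) : Prop :=
  analytic_in_E f /\ exists a : nat -> C, has_expansion f a.

Definition class_R (f : C -> C) : Prop :=
  class_A f /\ forall z : C, in_E z -> (0 < Re (C_derive f z))%R.

(* Integral of g along the segment t = s z, 0 <= s <= 1, so dt = z ds. *)
Definition segment_integral (g : C -> C) (z : C) : C :=
  RInt (V := C_R_CompleteNormedModule) (fun s : R => g (RtoC s * z) * z) 0 1.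

Definition extremal (z : C) : C :=
  segment_integral (fun t : C => (1 + t ^ 3) / (1 - t ^ 3)) z.

(* Main.v *)
Require Import Defs.
From Stdlib Require Import Reals Lra Lia.
From Coquelicot Require Import Coquelicot.
Local Open Scope C_scope.

(** Why the bound holds.  Write [p = f' = 1 + c_1 z + c_2 z^2 + ...], so that
    [c_n = (n+1) a_(n+1)] and [a_2 a_3 - a_4 = - (c_3 - (2/3) c_1 c_2) / 4]; the
    claim becomes [|c_3 - (2/3) c_1 c_2| <= 2] for a function [p] with positive
    real part and [p(0) = 1].  Suppose first that [p] is defined up to the unit
    circle.  It then gives a positive form
    [<u, v> = 2 * mean of Re p * u * conj v] on that circle, for which
    the vectors [v_k = z^k] have [|v_k|^2 = 2] and [c_k] as inner products of
    vectors at distance [k].  Up to conjugations, [c_3 - (2/3) c_1 c_2] is the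
    inner product of [v_0] with [(I - (4/3) P) v_3], where [P] is the orthogonal
    projection onto the line of [v_1]; the operator [I - (4/3) P] has
    eigenvalues [1] and [-1/3], so it is a contraction and Cauchy-Schwarz gives
    the bound [2].

    Concretely, Cauchy-Schwarz is the positivity of the mean of
    [Re p * |mu + z^3 - s z|^2] with [conj s = (2/3) c_2] and [|mu| = 1]
    ([polynomial_positivity], [coefficient_bound_on_circle]).  The mean is a
    finite one, over roots of unity of large order, which reads off the
    coefficients of polynomials of smaller degree exactly.  The
    passage from polynomials to [p] replaces [p] on the circle [|z| = r < 1] by a
    Taylor polynomial plus a small positive constant ([series_positivity]); both
    terms of [c_3 - (2/3) c_1 c_2] scale by [r^3], which leaves only [r -> 1]
    ([caratheodory_bound]).

    Sharpness.  The kernel [(1 + t^3) / (1 - t^3) = 1 + 2 t^3 + 2 t^6 + ...] is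
    integrated term by term along segments, which gives [a_2 = a_3 = 0] and
    [a_4 = 1/2].  Both halves rest on termwise differentiation of complex power
    series ([is_derive_pseries]): it identifies [f'] with its series, it provides
    the primitive for the fundamental theorem of calculus
    ([segment_integral_pseries]), and it shows that the extremal function is
    analytic with derivative the kernel, whose real part is positive. *)

(** * Complex power series and their derivatives *)

Lemma is_pseries_Cpow (a : nat -> C) (z l : C) :
  is_pseries a z l <-> is_series (fun n => a n * z ^ n) l.
Proof.
  assert (H : forall n, scal (pow_n z n) (a n) = a n * z ^ n).
  { intros n. change (pow_n z n * a n = a n * z ^ n).
    apply Cmult_comm. }
  split; apply is_series_ext; intros n; simpl; [|symmetry]; apply H.
Qed.

Lemma is_series_C_unique (u : nat -> C) (l m : C) :
  is_series u l -> is_series u m -> l = m.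
Proof.
  intros Hl Hm.
  exact (filterlim_locally_unique (K := C_AbsRing) (V := C_NormedModule) _ _ _ Hl Hm).
Qed.

Lemma ex_series_C (u : nat -> C) :
  ex_series (fun n => Cmod (u n)) -> exists l : C, is_series u l.
Proof.
  intros H.
  destruct (ex_series_le (V := C_R_CompleteNormedModule) u (fun n => Cmod (u n)))
    as [l Hl].
  - intros n. rewrite Cmod_norm. apply Rle_refl.
  - exact H.
  - exists l. exact Hl.
Qed.

Lemma is_series_C_bounded (u : nat -> C) (l : C) :
  is_series u l -> exists M : R, forall n, (Cmod (u n) <= M)%R.
Proof.
  intros Hl.
  destruct (filterlim_bounded (K := C_AbsRing) (V := C_NormedModule) (sum_n u))
    as [M HM]; [now exists l|].
  assert (HS : forall n, (Cmod (sum_n u n) <= M)%R) by exact HM.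
  exists (M + M)%R. intros [|n].
  - pose proof (HS 0%nat) as H0. rewrite sum_O in H0.
    pose proof (Cmod_ge_0 (u 0%nat)). lra.
  - replace (u (S n)) with (sum_n u (S n) + - sum_n u n).
    + eapply Rle_trans; [apply Cmod_triangle|]. rewrite Cmod_opp.
      now apply Rplus_le_compat.
    + rewrite sum_Sn. change (sum_n u n + u (S n) + - sum_n u n = u (S n)). ring.
Qed.

Lemma is_series_Cmod_le (u : nat -> C) (v : nat -> R) (l : C) (L : R) :
  is_series u l -> is_series v L -> (forall n, (Cmod (u n) <= v n)%R) -> (Cmod l <= L)%R.
Proof.
  intros Hu Hv Huv.
  assert (Hs : forall n, (Cmod (sum_n u n) <= sum_n v n)%R).
  { induction n as [|n IH].
    - rewrite !sum_O. apply Huv.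
    - rewrite !sum_Sn. eapply Rle_trans; [apply Cmod_triangle|].
      apply Rplus_le_compat; auto. }
  apply (filterlim_le (F := eventually) (fun n => Cmod (sum_n u n)) (sum_n v)
           (Finite (Cmod l)) (Finite L)).
  - exists 0%nat. intros n _. apply Hs.
  - change (filterlim (fun n => Cmod (sum_n u n)) eventually (locally (Cmod l))).
    apply (filterlim_comp _ _ _ (sum_n u) Cmod eventually (locally l)); [exact Hu|].
    exact (filterlim_norm (K := C_AbsRing) (V := C_NormedModule) l).
  - exact Hv.
Qed.

(** The quadratic Taylor bound for a power, uniform on the disk of radius [r].
    It follows by induction from
    [w^(n+2) - z^(n+2) - (n+2) z^(n+1) h
     = w (w^(n+1) - z^(n+1) - (n+1) z^n h) + (n+1) z^n h^2] with [h = w - z].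
    The constant is not optimal; it is the coefficient that a second derivative
    produces, so the bounds sum to a twice differentiated real power series. *)
Lemma Cpow_taylor2 (z w : C) (r : R) (n : nat) :
  (Cmod z <= r)%R -> (Cmod w <= r)%R ->
  (Cmod (w ^ S n - z ^ S n - INR (S n) * z ^ n * (w - z))
   <= INR n * INR (S n) * r ^ pred n * Cmod (w - z) ^ 2)%R.
Proof.
  intros Hz Hw.
  induction n as [|n IH].
  - replace (w ^ 1 - z ^ 1 - INR 1 * z ^ 0 * (w - z)) with (RtoC 0)
      by (simpl; ring).
    rewrite Cmod_0. simpl. lra.
  - replace (w ^ S (S n) - z ^ S (S n) - INR (S (S n)) * z ^ S n * (w - z))
      with (w * (w ^ S n - z ^ S n - INR (S n) * z ^ n * (w - z))
            + INR (S n) * z ^ n * ((w - z) * (w - z)))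
      by (rewrite !S_INR, !RtoC_plus; simpl; ring).
    eapply Rle_trans; [apply Cmod_triangle|].
    rewrite !Cmod_mult, Cmod_R, Rabs_pos_eq by apply pos_INR.
    rewrite Cmod_pow.
    replace (Cmod (w - z) * Cmod (w - z))%R with (Cmod (w - z) ^ 2)%R by ring.
    set (d := (Cmod (w - z) ^ 2)%R) in *.
    assert (Hd : (0 <= d)%R) by apply pow2_ge_0.
    assert (Hr : (0 <= r)%R) by (pose proof (Cmod_ge_0 z); lra).
    assert (Hn : (0 <= INR n)%R) by apply pos_INR.
    assert (H1 : (Cmod w * Cmod (w ^ S n - z ^ S n - INR (S n) * z ^ n * (w - z))
                  <= r * (INR n * INR (S n) * r ^ pred n * d))%R).
    { apply Rmult_le_compat; auto using Cmod_ge_0. }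
    assert (H2 : (INR (S n) * Cmod z ^ n * d <= INR (S n) * r ^ n * d)%R).
    { apply Rmult_le_compat_r; [exact Hd|].
      apply Rmult_le_compat_l; [apply pos_INR|].
      apply pow_incr. split; [apply Cmod_ge_0|exact Hz]. }
    assert (H3 : (r * (INR n * INR (S n) * r ^ pred n * d)
                  = INR n * INR (S n) * r ^ n * d)%R).
    { destruct n; simpl; ring. }
    rewrite H3 in H1. simpl pred.
    assert (H4 : (0 <= r ^ n * d)%R) by (apply Rmult_le_pos; [now apply pow_le|exact Hd]).
    rewrite (S_INR (S n)), S_INR in *.
    nra.
Qed.

Definition converges_in_E (a : nat -> C) : Prop :=
  forall z : C, in_E z -> exists l : C, is_pseries a z l.

(** Terms of a series that converges at a point [r < 1] are bounded there, and
    the radius of convergence is the supremum of the radii with bounded terms.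
    This hands the absolute convergence of complex series over to the theory of
    real power series with coefficients [|a n|]. *)
Lemma CV_radius_converges_in_E (a : nat -> C) :
  converges_in_E a -> Rbar_le 1%R (CV_radius (fun n => Cmod (a n))).
Proof.
  intros Ha.
  destruct (CV_radius_bounded (fun n => Cmod (a n))) as [Hub _].
  apply Rbar_not_lt_le. intros Hlt.
  assert (Hrad : forall r : R, (0 <= r < 1)%R -> Rbar_le r (CV_radius (fun n => Cmod (a n)))).
  { intros r Hr. apply Hub.
    assert (Hin : in_E (RtoC r)).
    { unfold in_E. rewrite Cmod_R, Rabs_pos_eq; lra. }
    destruct (Ha _ Hin) as [l Hl]. apply is_pseries_Cpow in Hl.
    destruct (is_series_C_bounded _ _ Hl) as [M HM].
    exists M. intros n. specialize (HM n).
    rewrite Cmod_mult, Cmod_pow, Cmod_R, (Rabs_pos_eq r) in HM by lra.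
    rewrite Rabs_pos_eq; [exact HM|].
    apply Rmult_le_pos; [apply Cmod_ge_0|apply pow_le; lra]. }
  destruct (CV_radius (fun n => Cmod (a n))) as [c| |] eqn:E; simpl in *.
  (* A finite radius c < 1 is beaten by the midpoint of c and 1. *)
  - pose proof (Hrad 0%R ltac:(lra)).
    pose proof (Hrad ((c + 1) / 2)%R ltac:(lra)). lra.
  - exact Hlt.
  - exact (Hrad 0%R ltac:(lra)).
Qed.

Lemma ex_series_Cmod (a : nat -> C) (r : R) :
  Rbar_le 1%R (CV_radius (fun n => Cmod (a n))) -> (0 <= r < 1)%R ->
  ex_series (fun n => Cmod (a n) * r ^ n)%R.
Proof.
  intros Ha Hr.
  apply (ex_series_ext (fun n => Rabs (Cmod (a n) * r ^ n))).
  { intros n. apply Rabs_pos_eq.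
    apply Rmult_le_pos; [apply Cmod_ge_0|apply pow_le; lra]. }
  apply CV_disk_inside.
  apply Rbar_lt_le_trans with (2 := Ha). simpl. rewrite Rabs_pos_eq; lra.
Qed.

Lemma is_derive_of_quadratic_bound (F : C -> C) (z l : C) (K r : R) :
  (0 < r)%R ->
  (forall w, (Cmod (w - z) < r)%R ->
     (Cmod (F w - F z - (w - z) * l) <= K * Cmod (w - z) ^ 2)%R) ->
  is_derive (K := C_AbsRing) (V := C_NormedModule) F z l.
Proof.
  intros Hr HF.
  split; [apply is_linear_scal_l|].
  intros x Hx.
  apply (is_filter_lim_locally_unique (V := AbsRing_NormedModule C_AbsRing)) in Hx.
  subst x.
  intros eps.
  set (d := Rmin r (eps / (Rabs K + 1))).
  assert (HK : (0 <= Rabs K)%R) by apply Rabs_pos.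
  assert (He : (0 < eps / (Rabs K + 1))%R).
  { apply Rdiv_lt_0_compat; [apply cond_pos|lra]. }
  assert (Hd : (0 < d)%R) by (now apply Rmin_pos).
  exists (mkposreal d Hd). intros w Hw.
  change (Cmod (w - z) < d)%R in Hw.
  change (Cmod (F w - F z - (w - z) * l) <= eps * Cmod (w - z))%R.
  eapply Rle_trans; [apply HF; apply Rlt_le_trans with (1 := Hw); apply Rmin_l|].
  assert (Hw2 : (Cmod (w - z) <= eps / (Rabs K + 1))%R).
  { apply Rlt_le, Rlt_le_trans with (1 := Hw), Rmin_r. }
  pose proof (Cmod_ge_0 (w - z)) as Hp.
  apply (Rmult_le_compat_l (Rabs K + 1)) in Hw2; [|lra].
  replace ((Rabs K + 1) * (eps / (Rabs K + 1)))%R with (pos eps) in Hw2 by (field; lra).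
  pose proof (Rle_abs K). nra.
Qed.

Definition derived_coef (a : nat -> C) (n : nat) : C := INR (S n) * a (S n).

(** Termwise differentiation.  Summing the quadratic bounds [Cpow_taylor2]
    against the coefficients gives a Taylor remainder of order [|w - z|^2]; the
    sum is finite because differentiating a real power series keeps its radius
    of convergence. *)
Lemma is_derive_pseries (a : nat -> C) (F : C -> C) (z : C) :
  (forall w, in_E w -> is_pseries a w (F w)) -> in_E z ->
  exists l : C, is_pseries (derived_coef a) z l /\
    is_derive (K := C_AbsRing) (V := C_NormedModule) F z l.
Proof.
  intros HF Hz.
  set (A := fun n => Cmod (a n)).
  assert (HA : Rbar_le 1%R (CV_radius A)).
  { apply CV_radius_converges_in_E. intros w Hw. exists (F w). now apply HF. }
  assert (Hz0 := Cmod_ge_0 z). unfold in_E in Hz.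
  (* A radius strictly between |z| and 1, so that a neighbourhood of z lies in
     the closed disk of radius r. *)
  set (r := ((Cmod z + 1) / 2)%R).
  assert (Hr : (0 <= r < 1)%R) by (unfold r; lra).
  assert (Hl : exists l : C, is_series (fun n => derived_coef a n * z ^ n) l).
  { apply ex_series_C.
    apply (ex_series_ext (fun n => Rabs (PS_derive A n * Cmod z ^ n))).
    - intros n. unfold PS_derive, derived_coef, A.
      rewrite !Cmod_mult, Cmod_pow, Cmod_R, (Rabs_pos_eq (INR (S n))) by apply pos_INR.
      apply Rabs_pos_eq. repeat apply Rmult_le_pos;
        auto using pos_INR, Cmod_ge_0, pow_le.
    - apply CV_disk_inside. rewrite CV_radius_derive.
      apply Rbar_lt_le_trans with (2 := HA). simpl. rewrite Rabs_pos_eq; lra. }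
  destruct Hl as [l Hl].
  assert (HK : ex_series (fun n => INR n * INR (S n) * A (S n) * r ^ pred n)%R).
  { apply ex_series_incr_1.
    apply (ex_series_ext (fun n => Rabs (PS_derive (PS_derive A) n * r ^ n))).
    - intros n. unfold PS_derive.
      rewrite Rabs_pos_eq.
      + simpl pred. change (@eq R (INR (S n) * (INR (S (S n)) * A (S (S n))) * r ^ n)
          (INR (S n) * INR (S (S n)) * A (S (S n)) * r ^ n))%R. ring.
      + repeat apply Rmult_le_pos; try apply pos_INR; [apply Cmod_ge_0|now apply pow_le]. 
    - apply CV_disk_inside. rewrite !CV_radius_derive.
      apply Rbar_lt_le_trans with (2 := HA). simpl. rewrite Rabs_pos_eq; lra. }
  destruct HK as [K HK].
  exists l. split; [now apply is_pseries_Cpow|].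
  apply (is_derive_of_quadratic_bound F z l K (r - Cmod z)); [unfold r; lra|].
  intros w Hw.
  assert (Hwr : (Cmod w <= r)%R).
  { replace w with (z + (w - z)) by ring.
    pose proof (Cmod_triangle z (w - z)). lra. }
  assert (HwE : in_E w) by (unfold in_E; lra).
  pose proof (proj1 (is_pseries_Cpow _ _ _) (HF w HwE)) as Sw.
  pose proof (proj1 (is_pseries_Cpow _ _ _) (HF z Hz)) as Sz.
  assert (S0 : is_series (fun n => a n * w ^ n - a n * z ^ n) (F w - F z)).
  { exact (is_series_minus _ _ _ _ Sw Sz). }
  assert (S1 : is_series (fun n => a (S n) * w ^ S n - a (S n) * z ^ S n) (F w - F z)).
  { apply (is_series_incr_1 (fun n => a n * w ^ n - a n * z ^ n)).
    replace (plus (F w - F z) _) with (F w - F z); [exact S0|].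
    change (@eq C (F w - F z) (F w - F z + (a 0%nat * 1 - a 0%nat * 1))). ring. }
  pose proof (is_series_scal (K := C_AbsRing) (V := C_NormedModule) (w - z) _ _ Hl) as S2.
  pose proof (is_series_minus _ _ _ _ S1 S2) as S3.
  rewrite (Rmult_comm K).
  apply (is_series_Cmod_le _ _ _ _ S3
           (is_series_scal (V := R_NormedModule) (Cmod (w - z) ^ 2)%R _ _ HK)).
  intros n.
  replace (plus _ _) with (a (S n) * (w ^ S n - z ^ S n - INR (S n) * z ^ n * (w - z))).
  2:{ change (a (S n) * (w ^ S n - z ^ S n - INR (S n) * z ^ n * (w - z))
        = a (S n) * w ^ S n - a (S n) * z ^ S n
          - (w - z) * (INR (S n) * a (S n) * z ^ n)). ring. }
  rewrite Cmod_mult.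
  eapply Rle_trans.
  { apply Rmult_le_compat_l; [apply Cmod_ge_0|].
    apply Cpow_taylor2; [|exact Hwr]. unfold r; lra. }
  apply Req_le. unfold A. change (scal ?x ?y) with (x * y)%R. ring.
Qed.

(** * Means over roots of unity *)

(* [sum_n] and [plus] leave equations at the carrier of an abstract structure;
   [ring] needs to see the type [C]. *)
Ltac Cring := lazymatch goal with |- ?x = ?y => change (@eq C x y); ring end.

Definition delta (k n : nat) : C := if Nat.eqb n k then 1 else 0.

Lemma sum_n_delta (c : nat -> C) (k K : nat) :
  (k <= K)%nat -> sum_n (fun n => c n * delta k n) K = c k.
Proof.
  intros Hk.
  assert (H : sum_n (fun n => c n * delta k n) K = if Nat.leb k K then c k else RtoC 0).
  { clear Hk. unfold delta. induction K as [|K IH].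
    - rewrite sum_O. destruct k; simpl; Cring.
    - rewrite sum_Sn, IH. change plus with Cplus.
      destruct (Nat.eqb_spec (S K) k) as [<-|Hne].
      + rewrite (proj2 (Nat.leb_gt (S K) K)) by lia. rewrite Nat.leb_refl. Cring.
      + destruct (Nat.leb_spec k K), (Nat.leb_spec k (S K)); try lia; Cring. }
  rewrite H. now rewrite (proj2 (Nat.leb_le _ _) Hk).
Qed.

Lemma Re_sum_n_nonneg (h : nat -> C) (M : nat) :
  (forall j, (0 <= Re (h j))%R) -> (0 <= Re (sum_n h M))%R.
Proof.
  intros Hh. induction M as [|M IH].
  - rewrite sum_O. apply Hh.
  - rewrite sum_Sn. change (0 <= Re (sum_n h M) + Re (h (S M)))%R.
    now apply Rplus_le_le_0_compat.
Qed.

Definition unit_root (N : nat) : C :=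
  (cos (2 * PI / INR N), sin (2 * PI / INR N)).

Lemma unit_root_pow (N m : nat) :
  unit_root N ^ m = (cos (INR m * (2 * PI / INR N)), sin (INR m * (2 * PI / INR N))).
Proof.
  unfold unit_root. set (t := (2 * PI / INR N)%R).
  induction m as [|m IH].
  - simpl. rewrite Rmult_0_l, cos_0, sin_0. reflexivity.
  - rewrite Cpow_S, IH, S_INR.
    replace ((INR m + 1) * t)%R with (t + INR m * t)%R by ring.
    rewrite cos_plus, sin_plus. unfold Cmult. simpl. f_equal; ring.
Qed.

Lemma unit_root_pow_order (N : nat) : (0 < N)%nat -> unit_root N ^ N = 1.
Proof.
  intros HN. rewrite unit_root_pow.
  replace (INR N * (2 * PI / INR N))%R with (2 * PI)%R.
  - now rewrite cos_2PI, sin_2PI.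
  - field. apply not_0_INR. lia.
Qed.

Lemma unit_root_pow_neq_1 (N m : nat) : (0 < m < N)%nat -> unit_root N ^ m <> 1.
Proof.
  intros Hm. rewrite unit_root_pow. intros H.
  apply (f_equal fst) in H. simpl in H.
  set (x := (INR m * PI / INR N)%R).
  assert (HmN : (0 < INR m < INR N)%R).
  { split; [apply (lt_INR 0)|apply lt_INR]; lia. }
  replace (INR m * (2 * PI / INR N))%R with (2 * x)%R in H
    by (unfold x; field; apply not_0_INR; lia).
  rewrite cos_2a_sin in H.
  assert (Hx : (0 < sin x)%R).
  { pose proof PI_RGT_0. unfold x. apply sin_gt_0.
    - apply Rdiv_lt_0_compat; nra.
    - apply (Rmult_lt_reg_r (INR N)); [lra|].
      unfold Rdiv. rewrite Rmult_assoc, Rinv_l by (apply not_0_INR; lia). nra. }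
  nra.
Qed.

Lemma Cmod_unit_root (N : nat) : Cmod (unit_root N) = 1%R.
Proof.
  unfold Cmod, unit_root. simpl.
  apply Rsqr_inj; [apply sqrt_pos|lra|]. rewrite Rsqr_sqrt, Rsqr_1 by nra.
  pose proof (sin2_cos2 (2 * PI / INR N)) as H. unfold Rsqr in H. lra.
Qed.

Lemma geometric_sum (x : C) (M : nat) :
  (x - 1) * sum_n (fun j => x ^ j) M = x ^ S M - 1.
Proof.
  induction M as [|M IH].
  - rewrite sum_O. simpl. Cring.
  - rewrite sum_Sn. change plus with Cplus.
    rewrite Cmult_plus_distr_l, IH. simpl. Cring.
Qed.

(** Orthogonality of characters.  The bound on [m] leaves [0] and the order
    [S M] as the only exponents on which the sum does not cancel. *)
Lemma sum_unit_root_pow (M m : nat) :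
  (m < 2 * S M)%nat ->
  sum_n (fun j => (unit_root (S M) ^ j) ^ m) M
  = RtoC (INR (S M)) * (delta 0 m + delta (S M) m).
Proof.
  intros Hm. set (w := unit_root (S M)).
  assert (HN : w ^ S M = 1) by (apply unit_root_pow_order; lia).
  rewrite (sum_n_ext _ (fun j => (w ^ m) ^ j)).
  2:{ intros j. rewrite <- !Cpow_mult_r. f_equal. lia. }
  assert (H1 : w ^ m = 1 -> sum_n (fun j => (w ^ m) ^ j) M = RtoC (INR (S M))).
  { intros ->. rewrite (sum_n_ext _ (fun _ => RtoC 1)) by (intros; apply Cpow_1_l).
    clear. induction M as [|M IH]; [now rewrite sum_O|].
    rewrite sum_Sn, IH, (S_INR (S M)), RtoC_plus. reflexivity. }
  unfold delta.
  destruct (Nat.eqb_spec m 0) as [->|H0].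
  { rewrite H1 by reflexivity. cbn [Nat.eqb]. Cring. }
  destruct (Nat.eqb_spec m (S M)) as [->|HS].
  { rewrite H1 by exact HN. Cring. }
  assert (Hne : w ^ m <> 1).
  { destruct (Nat.lt_ge_cases m (S M)) as [Hlt|Hge].
    - apply unit_root_pow_neq_1. lia.
    - replace m with (S M + (m - S M))%nat by lia.
      rewrite Cpow_add_r, HN, Cmult_1_l. apply unit_root_pow_neq_1. lia. }
  pose proof (geometric_sum (w ^ m) M) as G.
  rewrite <- Cpow_mult_r, Nat.mul_comm, Cpow_mult_r, HN, Cpow_1_l in G.
  destruct (Ceq_dec (sum_n (fun j => (w ^ m) ^ j) M) 0) as [->|Hs]; [Cring|].
  exfalso. apply (Cmult_neq_0 (w ^ m - 1) _) in Hs.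
  - apply Hs. rewrite G. Cring.
  - intros E. apply Hne. replace (w ^ m) with (w ^ m - 1 + 1) by Cring. rewrite E. Cring.
Qed.

(** At a root of unity conjugate powers are ordinary powers, so that trigonometric
    sums become polynomial sums. *)
Lemma Cpow_conj_root (N k : nat) (z : C) :
  Cmod z = 1%R -> z ^ N = 1 -> (k <= N)%nat -> Cconj z ^ k = z ^ (N - k).
Proof.
  intros Hz HN Hk.
  assert (H1 : z * Cconj z = 1) by (rewrite <- Cmod2_conj, Hz; f_equal; ring).
  replace (Cconj z ^ k) with (z ^ N * Cconj z ^ k) by (rewrite HN; Cring).
  replace N with (N - k + k)%nat at 1 by lia.
  rewrite Cpow_add_r, <- Cmult_assoc, <- Cpow_mult_l, H1, Cpow_1_l. Cring.
Qed.

Lemma sum_n_Cmult_l (c : C) (u : nat -> C) (n : nat) :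
  sum_n (fun k => c * u k) n = c * sum_n u n.
Proof. exact (sum_n_mult_l (K := C_Ring) c u n). Qed.

(** Summing [P(z) |mu + z^3 - s z|^2] over the roots of unity of order [K + 4]
    reads off the coefficients of the polynomial [P] that are matched by the
    weight, and every summand has nonnegative real part.  This is the instance of
    the positive semidefiniteness of the Toeplitz matrix of [P] at the vector
    with entries [mu, -s, 0, 1]. *)
Lemma polynomial_positivity (b : nat -> C) (K : nat) (mu s : C) :
  (3 <= K)%nat ->
  (forall z : C, Cmod z = 1%R -> (0 <= Re (sum_n (fun n => b n * z ^ n)%C K))%R) ->
  (0 <= Re (b 0%nat * (mu * Cconj mu + 1 + s * Cconj s)
            + mu * b 3%nat - mu * Cconj s * b 1%nat - s * b 2%nat))%R.
Proof.
  intros HK Hb.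
  (* The order must exceed K + 3: then the exponents n + k with n <= K and
     1 <= k <= 3 lie strictly between 0 and S M. *)
  set (M := (K + 3)%nat). set (w := unit_root (S M)).
  set (Q := fun z : C => mu + z ^ 3 - s * z).
  set (V := b 0%nat * (mu * Cconj mu + 1 + s * Cconj s)
            + mu * b 3%nat - mu * Cconj s * b 1%nat - s * b 2%nat).
  assert (Hw : forall j, Cmod (w ^ j) = 1%R).
  { intros j. rewrite Cmod_pow. unfold w. rewrite Cmod_unit_root. apply pow1. }
  assert (HwN : forall j, (w ^ j) ^ S M = 1).
  { intros j. rewrite <- Cpow_mult_r, Nat.mul_comm, Cpow_mult_r.
    unfold w. rewrite unit_root_pow_order by lia. apply Cpow_1_l. }
  set (h := fun z : C => sum_n (fun n => b n * z ^ n) K * (Q z * Cconj (Q z))).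
  assert (Hh : forall j, (0 <= Re (h (w ^ j)%C))%R).
  { intros j. unfold h. rewrite <- Cmod2_conj.
    pose proof (Hb _ (Hw j)) as H1. pose proof (pow2_ge_0 (Cmod (Q (w ^ j)%C))) as H2.
    replace (Re _) with (Re (sum_n (fun n => b n * (w ^ j) ^ n)%C K) * Cmod (Q (w ^ j)%C) ^ 2)%R.
    - now apply Rmult_le_pos.
    - simpl. ring. }
  assert (Hsum : sum_n (fun j => h (w ^ j)) M = RtoC (INR (S M)) * V).
  { assert (Hmono : forall n, (n <= K)%nat ->
      sum_n (fun j => (w ^ j) ^ n * (Q (w ^ j) * Cconj (Q (w ^ j)))) M
      = RtoC (INR (S M)) * ((mu * Cconj mu + 1 + s * Cconj s) * delta 0 n
          + mu * delta 3 n - mu * Cconj s * delta 1 n - s * delta 2 n)).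
    { intros n Hn.
      set (e := fun m => sum_n (fun j => (w ^ j) ^ m) M).
      assert (He : forall m, (m < 2 * S M)%nat ->
                e m = RtoC (INR (S M)) * (delta 0 m + delta (S M) m)).
      { intros m Hm. now apply sum_unit_root_pow. }
      (* The seven terms of the expanded weight, with conj z ^ k = z ^ (S M - k). *)
      transitivity ((mu * Cconj mu + 1 + s * Cconj s) * e n
         + mu * e (n + (S M - 3))%nat + Cconj mu * e (n + 3)%nat
         + - (mu * Cconj s) * e (n + (S M - 1))%nat
         + - (Cconj mu * s) * e (n + 1)%nat
         + - Cconj s * e (n + 2)%nat + - s * e (n + (S M - 2))%nat).
      { unfold e. rewrite <- !sum_n_Cmult_l.
        repeat rewrite <- (sum_n_plus (G := C_AbelianMonoid)).
        apply sum_n_ext. intros j. change plus with Cplus.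
        set (z := w ^ j). rewrite !Cpow_add_r.
        rewrite <- !(Cpow_conj_root (S M) _ z) by (unfold z; auto; unfold M; lia).
        unfold Q. rewrite Cminus_conj, Cplus_conj, Cmult_conj, Cpow_conj.
        assert (H1 : z * Cconj z = 1).
        { rewrite <- Cmod2_conj. unfold z. rewrite Hw. f_equal. ring. }
        set (zb := Cconj z) in *.
        transitivity (z ^ n * (mu * Cconj mu + (z * zb) ^ 3 + s * Cconj s * (z * zb)
          + mu * zb ^ 3 + Cconj mu * z ^ 3 - mu * Cconj s * zb - Cconj mu * s * z
          - Cconj s * z ^ 2 * (z * zb) - s * zb ^ 2 * (z * zb))); [Cring|].
        rewrite H1. Cring. }
      rewrite !He by (unfold M; lia).
      unfold delta.
      repeat match goal with |- context [Nat.eqb ?x ?y] =>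
        destruct (Nat.eqb_spec x y); try (unfold M in *; lia) end; Cring. }
    transitivity (sum_n (fun n => b n *
          (INR (S M) * ((mu * Cconj mu + 1 + s * Cconj s) * delta 0 n
          + mu * delta 3 n - mu * Cconj s * delta 1 n - s * delta 2 n))) K).
    - transitivity (sum_n (fun j => sum_n (fun n =>
        b n * ((w ^ j) ^ n * (Q (w ^ j) * Cconj (Q (w ^ j))))) K) M).
      + apply sum_n_ext. intros j. unfold h. rewrite Cmult_comm, <- sum_n_Cmult_l.
        apply sum_n_ext. intros n. Cring.
      + rewrite sum_n_switch. apply sum_n_ext_loc. intros n Hn.
        now rewrite sum_n_Cmult_l, Hmono.
    - unfold V.
      set (N := RtoC (INR (S M))).
      transitivity (sum_n (fun n => (N * (mu * Cconj mu + 1 + s * Cconj s) * b n) * delta 0 n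
         + (N * mu * b n) * delta 3 n + (- N * mu * Cconj s * b n) * delta 1 n
         + (- N * s * b n) * delta 2 n) K).
      { apply sum_n_ext. intros n. Cring. }
      do 3 rewrite (sum_n_plus (G := C_AbelianMonoid)).
      rewrite !(sum_n_delta (fun n => _ * b n)) by lia.
      change plus with Cplus. Cring. }
  pose proof (Re_sum_n_nonneg (fun j => h (w ^ j)) M Hh) as Hpos.
  rewrite Hsum in Hpos.
  replace (Re (INR (S M) * V)) with (INR (S M) * Re V)%R in Hpos by (simpl; ring).
  assert (HM : (0 < INR (S M))%R) by (apply lt_0_INR; lia).
  apply (Rmult_le_reg_l (INR (S M))); [exact HM|]. now rewrite Rmult_0_r.
Qed.

(** * Coefficients of functions with positive real part *)

(** One truncation order serves all the series [sum b n * z^n] with [|z| = 1],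
    since they have the same moduli of terms. *)
Lemma uniform_tail (u : nat -> C) (eps : R) :
  ex_series (fun n => Cmod (u n)) -> (0 < eps)%R ->
  exists K, (3 <= K)%nat /\ forall (v : nat -> C) (l : C),
    (forall n, Cmod (v n) = Cmod (u n)) -> is_series v l ->
    (Cmod (l - sum_n v K) <= eps)%R.
Proof.
  intros [L HL] Heps. change R in (type of L).
  pose proof (proj1 (filterlim_locally (sum_n (fun n => Cmod (u n))) L) HL
                (mkposreal eps Heps)) as [K0 HK0].
  set (K := (K0 + 3)%nat).
  exists K. split; [unfold K; lia|].
  intros v l Hv Hl.
  assert (Hvt : is_series (fun n => v (S K + n)%nat) (l - sum_n v K)).
  { apply (is_series_incr_n v (S K)); [lia|]. simpl pred.
    match goal with |- is_series _ ?x => replace x with l end; [exact Hl|].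
    change (l = l - sum_n v K + sum_n v K). Cring. }
  assert (Hut : is_series (fun n => Cmod (u (S K + n)%nat))
                  (L - sum_n (fun n => Cmod (u n)) K)%R).
  { apply (is_series_incr_n (fun n => Cmod (u n)) (S K)); [lia|]. simpl pred.
    match goal with |- is_series _ ?x => replace x with L end; [exact HL|].
    set (S := sum_n (fun n => Cmod (u n)) K : R).
    change (@eq R L (Rplus (Rminus L S) S)). ring. }
  eapply Rle_trans.
  { apply (is_series_Cmod_le _ _ _ _ Hvt Hut). intros n. rewrite Hv. apply Rle_refl. }
  pose proof (HK0 K ltac:(unfold K; lia)) as HB.
  change (Rabs (sum_n (fun n => Cmod (u n)) K - L) < eps)%R in HB.
  apply Rabs_def2 in HB. lra.
Qed.

Lemma nonneg_of_perturbations (T X : R) :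
  (forall eps, (0 < eps)%R -> (0 <= eps * T + X)%R) -> (0 <= X)%R.
Proof.
  intros H. apply Rnot_lt_le. intros HX.
  assert (HT : (0 < Rabs T + 1)%R) by (pose proof (Rabs_pos T); lra).
  assert (He : (0 < - X / (2 * (Rabs T + 1)))%R) by (apply Rdiv_lt_0_compat; lra).
  pose proof (H _ He) as H1. set (e := (- X / (2 * (Rabs T + 1)))%R) in *.
  assert (E : (e * (2 * (Rabs T + 1)) = - X)%R) by (unfold e; field; lra).
  pose proof (Rle_abs T). nra.
Qed.

(** A truncation is within [eps] of the series on the unit circle, so adding
    [eps] to its constant coefficient restores a nonnegative real part and
    [polynomial_positivity] applies; then [eps] tends to [0]. *)
Lemma series_positivity (b : nat -> C) (mu s : C) :
  ex_series (fun n => Cmod (b n)) ->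
  (forall z l : C, Cmod z = 1%R -> is_series (fun n => b n * z ^ n) l -> (0 <= Re l)%R) ->
  (0 <= Re (b 0%nat * (mu * Cconj mu + 1 + s * Cconj s)
            + mu * b 3%nat - mu * Cconj s * b 1%nat - s * b 2%nat))%R.
Proof.
  intros Hb Hpos.
  apply (nonneg_of_perturbations (Re (mu * Cconj mu + 1 + s * Cconj s))).
  intros eps Heps.
  destruct (uniform_tail b eps Hb Heps) as (K & HK & Htail).
  set (b' := fun n => b n + RtoC eps * delta 0 n).
  pose proof (polynomial_positivity b' K mu s HK) as HP.
  match type of HP with ?A -> ?B => assert (HA : A) end.
  { intros z Hz.
    assert (Hmod : forall n, Cmod (b n * z ^ n) = Cmod (b n)).
    { intros n. rewrite Cmod_mult, Cmod_pow, Hz, pow1. ring. }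
    destruct (ex_series_C (fun n => b n * z ^ n)) as [l Hl].
    { apply (ex_series_ext (fun n => Cmod (b n))); [|exact Hb].
      intros n. now rewrite Hmod. }
    pose proof (Htail _ _ Hmod Hl) as Ht.
    replace (sum_n (fun n => b' n * z ^ n) K)
      with (sum_n (fun n => b n * z ^ n) K + RtoC eps).
    - pose proof (Hpos z l Hz Hl) as Hlpos.
      pose proof (re_le_Cmod (l - sum_n (fun n => b n * z ^ n) K)) as Hre.
      set (S := sum_n (fun n => b n * z ^ n) K) in *.
      pose proof (Rle_abs (Re (l - S))) as Ha.
      change (Re (l - S)) with (Re l - Re S)%R in *.
      change (Re (S + RtoC eps)) with (Re S + eps)%R. lra.
    - unfold b'.
      rewrite (sum_n_ext (fun n => (b n + RtoC eps * delta 0 n) * z ^ n)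
        (fun n => plus (b n * z ^ n) (RtoC eps * z ^ n * delta 0 n))).
      + rewrite (sum_n_plus (G := C_AbelianMonoid)).
        rewrite (sum_n_delta (fun n => RtoC eps * z ^ n)) by lia.
        change plus with Cplus. simpl. Cring.
      + intros n. change plus with Cplus. Cring. }
  specialize (HP HA). unfold b', delta in HP. simpl Nat.eqb in HP. cbv iota in HP.
  match goal with |- (0 <= ?x)%R => match type of HP with (0 <= ?y)%R =>
    replace x with y; [exact HP|] end end.
  set (W := mu * Cconj mu + 1 + s * Cconj s).
  unfold Re. simpl. ring.
Qed.

Lemma Cmod_le_of_rotations (X : C) (B : R) :
  (0 <= B)%R ->
  (forall mu : C, Cmod mu = 1%R -> (Re (mu * X) <= B)%R) -> (Cmod X <= B)%R.
Proof.
  intros HB H.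
  destruct (Ceq_dec X 0) as [->|HX]; [now rewrite Cmod_0|].
  apply Cmod_gt_0 in HX as Hp.
  pose proof (H (Cconj X / RtoC (Cmod X))) as H1.
  rewrite Cmod_div, Cmod_conj, Cmod_R, (Rabs_pos_eq (Cmod X)) in H1.
  2: now apply Rlt_le.
  2: { intros E. apply RtoC_inj in E. lra. }
  replace (Cconj X / RtoC (Cmod X) * X) with (RtoC (Cmod X)) in H1.
  - apply H1. field. lra.
  - replace (Cconj X / RtoC (Cmod X) * X) with (X * Cconj X / RtoC (Cmod X))
      by (unfold Cdiv; ring).
    rewrite <- Cmod2_conj, <- RtoC_div by lra. f_equal. field. lra.
Qed.

(** With [conj s = (2/3) b_2] the terms of [series_positivity] in [|b_2|^2] add up
    to [(4/9 - 2/3) |b_2|^2 <= 0], which leaves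
    [Re (mu (b_3 - (2/3) b_1 b_2)) <= 2] for every rotation [mu]. *)
Lemma coefficient_bound_on_circle (b : nat -> C) :
  b 0%nat = 1 -> ex_series (fun n => Cmod (b n)) ->
  (forall z l : C, Cmod z = 1%R -> is_series (fun n => b n * z ^ n) l -> (0 <= Re l)%R) ->
  (Cmod (b 3%nat - 2 / 3 * (b 1%nat * b 2%nat)) <= 2)%R.
Proof.
  intros Hb0 Hb Hpos.
  apply Cmod_le_of_rotations; [lra|].
  intros mu Hmu.
  (* The rotation enters with a sign, since positivity gives a lower bound. *)
  pose proof (series_positivity b (- mu) (2 / 3 * Cconj (b 2%nat)) Hb Hpos) as H.
  assert (Hmm : mu * Cconj mu = 1) by (rewrite <- Cmod2_conj, Hmu; f_equal; ring).
  assert (H2 : (0 <= Cmod (b 2%nat) ^ 2)%R) by apply pow2_ge_0.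
  rewrite Hb0 in H.
  match type of H with (0 <= Re ?x)%R =>
    replace x with (RtoC (2 - 2 / 9 * Cmod (b 2%nat) ^ 2)%R
      - mu * (b 3%nat - 2 / 3 * (b 1%nat * b 2%nat))) in H end.
  - change (0 <= (2 - 2 / 9 * Cmod (b 2%nat) ^ 2)
      - Re (mu * (b 3%nat - 2 / 3 * (b 1%nat * b 2%nat))))%R in H. lra.
  - rewrite RtoC_minus, RtoC_mult, Cmod2_conj, RtoC_div by lra.
    rewrite Copp_conj, Cmult_conj, Cconj_conj.
    replace (Cconj (2 / 3)) with (RtoC 2 / RtoC 3).
    2:{ rewrite <- RtoC_div by lra. unfold Cconj, RtoC. simpl. f_equal. ring. }
    replace (- mu * - Cconj mu) with (mu * Cconj mu) by ring. rewrite Hmm.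
    field. 
Qed.

(** The rescaled coefficients [c_n r^n] satisfy [coefficient_bound_on_circle] for
    every [r < 1], and [c_3 - (2/3) c_1 c_2] is homogeneous of degree 3 under
    this scaling. *)
Lemma caratheodory_bound (c : nat -> C) (p : C -> C) :
  c 0%nat = 1 ->
  (forall z, in_E z -> is_pseries c z (p z)) ->
  (forall z, in_E z -> (0 < Re (p z))%R) ->
  (Cmod (c 3%nat - 2 / 3 * (c 1%nat * c 2%nat)) <= 2)%R.
Proof.
  intros Hc0 Hp Hpos.
  set (X := c 3%nat - 2 / 3 * (c 1%nat * c 2%nat)).
  assert (HA : Rbar_le 1%R (CV_radius (fun n => Cmod (c n)))).
  { apply CV_radius_converges_in_E. intros w Hw. exists (p w). now apply Hp. }
  assert (Hr : forall r : R, (0 <= r < 1)%R -> (r ^ 3 * Cmod X <= 2)%R).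
  { intros r Hr.
    replace (r ^ 3 * Cmod X)%R with (Cmod (RtoC r ^ 3 * X)).
    2:{ rewrite Cmod_mult, Cmod_pow, Cmod_R, Rabs_pos_eq by lra. reflexivity. }
    replace (RtoC r ^ 3 * X) with (c 3%nat * RtoC r ^ 3
      - 2 / 3 * ((c 1%nat * RtoC r ^ 1) * (c 2%nat * RtoC r ^ 2))) by (unfold X; ring).
    apply (coefficient_bound_on_circle (fun n => c n * RtoC r ^ n)).
    - rewrite Hc0. simpl. ring.
    - apply (ex_series_ext (fun n => Cmod (c n) * r ^ n)%R); [|now apply ex_series_Cmod].
      intros n. rewrite Cmod_mult, Cmod_pow, Cmod_R, Rabs_pos_eq by lra. reflexivity.
    - intros z l Hz Hl.
      assert (Hin : in_E (RtoC r * z)).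
      { unfold in_E. rewrite Cmod_mult, Cmod_R, Hz, Rabs_pos_eq; lra. }
      rewrite (is_series_C_unique _ l (p (RtoC r * z)) Hl).
      + now apply Rlt_le, Hpos.
      + apply (is_series_ext (fun n => c n * (RtoC r * z) ^ n)).
        * intros n. rewrite Cpow_mult_l. Cring.
        * now apply is_pseries_Cpow, Hp. }
  apply Rnot_lt_le. intros Hlt.
  (* With r = 1 - e, (1 - e)^3 x >= (1 - 3 e) x, and e is chosen so that the right
     side is the midpoint of 2 and x. *)
  set (x := Cmod X) in *.
  set (e := ((x - 2) / (6 * x))%R).
  assert (He : (e * (6 * x) = x - 2)%R) by (unfold e; field; lra).
  assert (He0 : (0 < e < 1)%R) by nra.
  pose proof (Hr (1 - e)%R ltac:(lra)) as H.
  assert (HB : (1 - 3 * e <= (1 - e) ^ 3)%R) by nra.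
  nra.
Qed.

(** * The inequality for functions of bounded turning *)

Lemma class_R_bound (f : C -> C) (a : nat -> C) :
  class_R f -> has_expansion f a ->
  (Cmod (a 2%nat * a 3%nat - a 4%nat)%C <= 1 / 2)%R.
Proof.
  intros [_ Hre] (_ & Ha1 & Hf).
  assert (Hp : forall z, in_E z -> is_pseries (derived_coef a) z (C_derive f z)).
  { intros z Hz. destruct (is_derive_pseries a f z Hf Hz) as (l & Hl & Hd).
    now rewrite (is_C_derive_unique f z l Hd). }
  assert (Hc0 : derived_coef a 0%nat = 1) by (unfold derived_coef; rewrite Ha1; simpl; ring).
  pose proof (caratheodory_bound (derived_coef a) (C_derive f) Hc0 Hp Hre) as H.
  replace (derived_coef a 3%nat - 2 / 3 * (derived_coef a 1%nat * derived_coef a 2%nat))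
    with (- RtoC 4 * (a 2%nat * a 3%nat - a 4%nat)) in H.
  - rewrite Cmod_mult, Cmod_opp, Cmod_R, Rabs_pos_eq in H by lra. lra.
  - unfold derived_coef.
    replace (INR 4) with 4%R by (simpl; ring).
    replace (INR 3) with 3%R by (simpl; ring).
    replace (INR 2) with 2%R by (simpl; ring). field.
Qed.

(** * Termwise integration along segments *)

(** The chain rule along a real parameter: the scalar field changes from the
    complex to the real numbers. *)
Lemma is_derive_along_segment (F : C -> C) (z l : C) (s : R) :
  is_derive (K := C_AbsRing) (V := C_NormedModule) F (RtoC s * z) l ->
  is_derive (V := C_R_NormedModule) (fun t : R => F (RtoC t * z)) s (l * z).
Proof.
  intros [_ HF].
  split; [apply is_linear_scal_l|].
  intros x Hx. apply (is_filter_lim_locally_unique (V := R_NormedModule)) in Hx. subst x.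
  intros eps.
  assert (Hz : (0 < Cmod z + 1)%R) by (pose proof (Cmod_ge_0 z); lra).
  assert (He : (0 < eps / (Cmod z + 1))%R) by (apply Rdiv_lt_0_compat; [apply cond_pos|exact Hz]).
  destruct (HF (RtoC s * z) (fun P HP => HP) (mkposreal _ He)) as [d Hd].
  assert (Hd' : (0 < d / (Cmod z + 1))%R) by (apply Rdiv_lt_0_compat; [apply cond_pos|exact Hz]).
  exists (mkposreal _ Hd'). intros t Ht.
  change (Rabs (t - s) < d / (Cmod z + 1))%R in Ht.
  assert (Hts : Cmod (RtoC t * z - RtoC s * z) = (Rabs (t - s) * Cmod z)%R).
  { replace (RtoC t * z - RtoC s * z) with (RtoC (t - s) * z) by (rewrite RtoC_minus; ring).
    now rewrite Cmod_mult, Cmod_R. }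
  pose proof (Rabs_pos (t - s)) as Hp. pose proof (Cmod_ge_0 z) as Hz0.
  assert (Hball : (Cmod (RtoC t * z - RtoC s * z) < d)%R).
  { rewrite Hts. apply (Rmult_lt_compat_r (Cmod z + 1)) in Ht; [|exact Hz].
    unfold Rdiv in Ht. rewrite Rmult_assoc, Rinv_l, Rmult_1_r in Ht by lra. nra. }
  specialize (Hd _ Hball).
  change (Cmod (F (RtoC t * z)%C - F (RtoC s * z)%C - (RtoC t * z - RtoC s * z) * l)
     <= eps / (Cmod z + 1) * Cmod (RtoC t * z - RtoC s * z))%R in Hd.
  change (@norm R_AbsRing C_R_NormedModule
      (minus (F (RtoC t * z) - F (RtoC s * z)) (scal (t - s)%R (l * z)))%C
      <= eps * Rabs (t - s))%R.
  match goal with |- (norm ?x <= _)%R =>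
    replace x with (F (RtoC t * z) - F (RtoC s * z) - (RtoC t * z - RtoC s * z) * l) end.
  - rewrite <- Cmod_norm.
    eapply Rle_trans; [exact Hd|]. rewrite Hts.
    set (e := (eps / (Cmod z + 1))%R) in *.
    assert (E : (e * (Cmod z + 1) = eps)%R) by (unfold e; field; lra).
    rewrite <- E. nra.
  - rewrite scal_R_Cmult, RtoC_minus.
    change (minus ?x ?y) with (x - y). Cring.
Qed.

(** Here [derived_coef a] is the given series and [a] that of its primitive: the
    terms of the latter are the smaller ones. *)
Lemma converges_in_E_primitive (a : nat -> C) :
  converges_in_E (derived_coef a) -> converges_in_E a.
Proof.
  intros Ha z Hz.
  pose proof (CV_radius_converges_in_E _ Ha) as HR.
  assert (H0 := Cmod_ge_0 z). unfold in_E in Hz.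
  pose proof (ex_series_Cmod _ (Cmod z) HR ltac:(lra)) as Hs.
  destruct (ex_series_C (fun n => a n * z ^ n)) as [l Hl].
  - apply ex_series_incr_1.
    apply (ex_series_le (V := R_CompleteNormedModule) _ _) with (2 := Hs).
    intros n. change (Rabs (Cmod (a (S n) * z ^ S n))
       <= Cmod (derived_coef a n) * Cmod z ^ n)%R.
    unfold derived_coef.
    rewrite Rabs_pos_eq, !Cmod_mult, Cmod_pow, Cmod_R, Rabs_pos_eq
      by (apply pos_INR || apply Cmod_ge_0).
    pose proof (pos_INR n). rewrite S_INR. simpl.
    assert (HA : (0 <= Cmod (a (S n)) * Cmod z ^ n)%R).
    { apply Rmult_le_pos; [apply Cmod_ge_0|now apply pow_le]. }
    nra.
  - exists l. now apply is_pseries_Cpow.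
Qed.

(** Let [F] be the sum of the integrated series.  Termwise differentiation gives
    [F' = g], so [s |-> F (s z)] is a primitive of [g (s z) z], and the fundamental
    theorem of calculus evaluates the integral to [F z - F 0 = F z].  The
    integrand is continuous because [g] is itself a power series. *)
Lemma segment_integral_pseries (a : nat -> C) (g : C -> C) (z : C) :
  a 0%nat = 0 ->
  (forall t, in_E t -> is_pseries (derived_coef a) t (g t)) -> in_E z ->
  is_pseries a z (segment_integral g z).
Proof.
  intros Ha0 Hg Hz.
  assert (Hca : converges_in_E a).
  { apply converges_in_E_primitive. intros t Ht. exists (g t). now apply Hg. }
  assert (HFex : exists F : C -> C, forall w, in_E w -> is_pseries a w (F w)).
  { exists (fun w => iota (T := C_R_CompleteNormedModule) (fun l => is_pseries a w l)).
    intros w Hw. destruct (Hca w Hw) as [l Hl].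
    apply (iota_correct (V := C_R_CompleteNormedModule) (fun l => is_pseries a w l)).
    exists l. split; [exact Hl|]. intros m Hm.
    apply (is_series_C_unique (fun n => a n * w ^ n)); now apply is_pseries_Cpow. }
  destruct HFex as [F HF].
  assert (Hseg : forall s : R, (0 <= s <= 1)%R -> in_E (RtoC s * z)).
  { intros s Hs. unfold in_E in *. rewrite Cmod_mult, Cmod_R, Rabs_pos_eq by lra.
    pose proof (Cmod_ge_0 z). nra. }
  assert (HdF : forall w, in_E w -> is_derive (K := C_AbsRing) (V := C_NormedModule) F w (g w)).
  { intros w Hw. destruct (is_derive_pseries a F w HF Hw) as (l & Hl & Hd).
    replace (g w) with l; [exact Hd|].
    apply (is_series_C_unique (fun n => derived_coef a n * w ^ n));
      apply is_pseries_Cpow; auto. }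
  assert (HI : is_RInt (V := C_R_CompleteNormedModule)
                 (fun s : R => g (RtoC s * z) * z) 0 1
                 (minus (F (RtoC 1 * z)) (F (RtoC 0 * z)))).
  { apply (is_RInt_derive (V := C_R_CompleteNormedModule) (fun s : R => F (RtoC s * z))).
    - intros s Hs. rewrite Rmin_left, Rmax_right in Hs by lra.
      now apply is_derive_along_segment, HdF, Hseg.
    - intros s Hs. rewrite Rmin_left, Rmax_right in Hs by lra.
      destruct (is_derive_pseries (fun n => derived_coef a n * z) (fun t => g t * z)
                  (RtoC s * z)) as (l & _ & Hd).
      + intros t Ht. apply is_pseries_Cpow.
        pose proof (is_series_scal (K := C_AbsRing) (V := C_NormedModule) z _ _
          (proj1 (is_pseries_Cpow _ _ _) (Hg t Ht))) as H.
        change (scal z (g t)) with (z * g t) in H. rewrite Cmult_comm in H.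
        revert H. apply is_series_ext. intros n.
        change (scal z (derived_coef a n * t ^ n)) with (z * (derived_coef a n * t ^ n)).
        Cring.
      + now apply Hseg.
      + apply (ex_derive_continuous (V := C_R_NormedModule) (fun t : R => g (RtoC t * z) * z)).
        exists (l * z). now apply (is_derive_along_segment (fun t => g t * z)). }
  unfold segment_integral. rewrite (is_RInt_unique _ _ _ _ HI).
  match goal with |- is_pseries _ _ ?x => replace x with (F z) end; [now apply HF|].
  assert (H0 : F (RtoC 0 * z) = RtoC 0).
  { apply (is_series_C_unique (fun n => a n * (RtoC 0 * z) ^ n)).
    - apply is_pseries_Cpow, HF, Hseg. lra.
    - apply is_pseries_Cpow. rewrite Cmult_0_l.
      pose proof (is_pseries_0 (K := C_AbsRing) (V := C_NormedModule) a) as H.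
      rewrite Ha0 in H. exact H. }
  rewrite H0, Cmult_1_l. change (@eq C (F z) (F z - 0)). ring.
Qed.

(** * The extremal function *)

Definition kernel_coef (n : nat) : C :=
  if Nat.eqb n 0 then 1 else if Nat.eqb (n mod 3) 0 then 2 else 0.

Lemma one_minus_cube_neq_0 (t : C) : in_E t -> 1 - t ^ 3 <> 0.
Proof.
  intros Ht E.
  assert (H : t ^ 3 = 1) by (replace (t ^ 3) with (1 - (1 - t ^ 3)) by ring; rewrite E; ring).
  apply (f_equal Cmod) in H. rewrite Cmod_pow, Cmod_1 in H.
  unfold in_E in Ht. pose proof (Cmod_ge_0 t). nra.
Qed.

(** The sum [L] of the [t^(3k)] satisfies [L - 1 = t^3 L], and the kernel is
    [2 L - 1]. *)
Lemma is_pseries_kernel (t : C) :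
  in_E t -> is_pseries kernel_coef t ((1 + t ^ 3) / (1 - t ^ 3)).
Proof.
  intros Ht. apply is_pseries_Cpow.
  set (ind := fun n : nat => if Nat.eqb (n mod 3) 0 then RtoC 1 else RtoC 0).
  destruct (ex_series_C (fun n => ind n * t ^ n)) as [L HL].
  { apply (ex_series_le (V := R_CompleteNormedModule) _ (fun n => Cmod t ^ n)%R).
    - intros n. change (Rabs (Cmod (ind n * t ^ n)) <= Cmod t ^ n)%R.
      rewrite Rabs_pos_eq, Cmod_mult, Cmod_pow by apply Cmod_ge_0.
      assert (Hp : (0 <= Cmod t ^ n)%R) by (apply pow_le, Cmod_ge_0).
      unfold ind. destruct (Nat.eqb _ _); rewrite ?Cmod_1, ?Cmod_0; lra.
    - apply ex_series_geom. rewrite Rabs_pos_eq by apply Cmod_ge_0. exact Ht. }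
  assert (HLv : L = 1 / (1 - t ^ 3)).
  { assert (H3 : is_series (fun n => ind (3 + n)%nat * t ^ (3 + n)) (L - 1)).
    { apply (is_series_incr_n (fun n => ind n * t ^ n) 3); [lia|].
      match goal with |- is_series _ ?x => replace x with L; [exact HL|] end.
      simpl pred. rewrite !sum_Sn, sum_O. unfold ind. simpl Nat.modulo. simpl Nat.eqb.
      cbv iota. change plus with Cplus. simpl. Cring. }
    assert (H3' : is_series (fun n => ind (3 + n)%nat * t ^ (3 + n)) (t ^ 3 * L)).
    { apply (is_series_ext (fun n => t ^ 3 * (ind n * t ^ n))).
      - intros n. unfold ind. replace ((3 + n) mod 3)%nat with (n mod 3)%nat.
        + rewrite Cpow_add_r. Cring.
        + rewrite Nat.add_comm. symmetry. apply (Nat.Div0.mod_add n 1 3).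
      - exact (is_series_scal (K := C_AbsRing) (V := C_NormedModule) (t ^ 3) _ _ HL). }
    pose proof (is_series_C_unique _ _ _ H3 H3') as E.
    pose proof (one_minus_cube_neq_0 t Ht) as Hne.
    replace L with (((L - 1) + 1 - t ^ 3 * L) / (1 - t ^ 3)) by (now field).
    rewrite E. now field. }
  apply is_series_decr_1.
  apply (is_series_ext (fun n => 2 * (ind (S n) * t ^ S n))).
  { intros n. unfold ind, kernel_coef. simpl (Nat.eqb (S n) 0). cbv iota.
    destruct (Nat.eqb (S n mod 3) 0); Cring. }
  match goal with |- is_series _ ?x => replace x with (2 * (L - 1)) end.
  - apply (is_series_scal (K := C_AbsRing) (V := C_NormedModule) (RtoC 2)).
    apply (is_series_incr_1 (fun n => ind n * t ^ n)).
    match goal with |- is_series _ ?x => replace x with L; [exact HL|] end.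
    unfold ind. change plus with Cplus. simpl. Cring.
  - rewrite HLv. pose proof (one_minus_cube_neq_0 t Ht) as Hne.
    unfold kernel_coef. change plus with Cplus. change opp with Copp. simpl Nat.eqb. cbv iota.
    change (t ^ 0) with (RtoC 1). match goal with |- ?x = ?y => change (@eq C x y) end.
    now field.
Qed.

(** The real part is [(1 - |w|^2) / |1 - w|^2]. *)
Lemma Re_cayley_pos (w : C) : in_E w -> (0 < Re ((1 + w) / (1 - w)))%R.
Proof.
  intros Hw. unfold in_E in Hw.
  assert (H2 : (Re w ^ 2 + Im w ^ 2 < 1)%R).
  { rewrite <- Cmod2_alt. pose proof (Cmod_ge_0 w). nra. }
  destruct w as [x y]. simpl in H2.
  assert (Hd : (0 < (1 - x) ^ 2 + y ^ 2)%R) by nra.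
  replace (Re ((1 + (x, y)) / (1 - (x, y))))
    with ((1 - x ^ 2 - y ^ 2) / ((1 - x) ^ 2 + y ^ 2))%R.
  - apply Rdiv_lt_0_compat; nra.
  - unfold Cdiv, Cinv, Cmult, Cplus, Cminus, Copp, Re, RtoC. simpl. field. nra.
Qed.

Definition extremal_coef (n : nat) : C :=
  match n with 0%nat => 0 | S m => kernel_coef m / INR (S m) end.

Lemma derived_extremal_coef (n : nat) : derived_coef extremal_coef n = kernel_coef n.
Proof.
  unfold derived_coef, extremal_coef. field.
  intros E. apply RtoC_inj in E. now apply (not_0_INR (S n)).
Qed.

Lemma is_pseries_extremal (z : C) : in_E z -> is_pseries extremal_coef z (extremal z).
Proof.
  apply segment_integral_pseries; [reflexivity|].
  intros t Ht. apply (is_pseries_ext kernel_coef).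
  - intros n. symmetry. apply derived_extremal_coef.
  - now apply is_pseries_kernel.
Qed.

Lemma is_derive_extremal (z : C) :
  in_E z -> is_derive (K := C_AbsRing) (V := C_NormedModule) extremal z
              ((1 + z ^ 3) / (1 - z ^ 3)).
Proof.
  intros Hz.
  destruct (is_derive_pseries _ _ z is_pseries_extremal Hz) as (l & Hl & Hd).
  replace ((1 + z ^ 3) / (1 - z ^ 3)) with l; [exact Hd|].
  apply (is_series_C_unique (fun n => kernel_coef n * z ^ n)).
  - apply is_pseries_Cpow. revert Hl. apply is_pseries_ext, derived_extremal_coef.
  - now apply is_pseries_Cpow, is_pseries_kernel.
Qed.

Theorem theorem3p1 :
  (forall (f : C -> C) (a : nat -> C),
     class_R f -> has_expansion f a ->
     (Cmod (a 2%nat * a 3%nat - a 4%nat)%C <= 1 / 2)%R) /\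
  (class_R extremal /\
   exists a : nat -> C, has_expansion extremal a /\
     Cmod (a 2%nat * a 3%nat - a 4%nat)%C = (1 / 2)%R).
Proof.
  assert (Hexp : has_expansion extremal extremal_coef).
  { split; [reflexivity|]. split; [|exact is_pseries_extremal].
    unfold extremal_coef, kernel_coef. simpl. field. }
  split; [exact class_R_bound|]. split; [split; [split|]|].
  - intros z Hz. eexists. now apply is_derive_extremal.
  - now exists extremal_coef.
  - intros z Hz. rewrite (is_C_derive_unique _ _ _ (is_derive_extremal z Hz)).
    apply Re_cayley_pos. unfold in_E in *. rewrite Cmod_pow.
    pose proof (Cmod_ge_0 z). simpl. nra.
  - exists extremal_coef. split; [exact Hexp|].
    replace (_ - _) with (- RtoC (1 / 2)).
    + rewrite Cmod_opp, Cmod_R. apply Rabs_pos_eq. lra.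
    + unfold extremal_coef, kernel_coef.
      replace (INR 4) with 4%R by (simpl; ring). simpl.
      rewrite RtoC_div by lra. field.
      split; intros E; apply RtoC_inj in E; lra.
Qed.
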